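(* Let $\Delta$ be the clique complex of a chordal graph with at least two maximal cliques, with facets $S_1,\ldots,S_e$ in a fixed leaf order, facet cardinalities $n_m=|S_m|$, and separator cardinalities $r_1,\ldots,r_{e-1}$. For every $-1\le k<\dim\Delta$, the ring $\mathbb K[\Delta_{(k)}]$ has Krull dimension $k+1$ and multiplicity $$e\bigl(\mathbb K[\Delta_{(k)}]\bigr)=\sum_{m=1}^e\binom{n_m}{k+1}-\sum_{m=1}^{e-1}\binom{r_m}{k+1}.$$
   Context: $\mathbb K$ is a field. For a finite set $X$, put $R=\mathbb K[x:x\in X]$ with the standard grading. A simplicial complex $\Sigma$ on $X$ is a collection of subsets (faces) of $X$ closed under inclusion; elements of $X$ not lying in any face (ghost vertices) are allowed. Facets are the maximal faces, a face $F$ has dimension $|F|-1$, and $\dim\Sigma$ is the largest dimension of a face. The $k$-skeleton $\Sigma_{(k)}$ consists of all faces of dimension at most $k$, viewed as a complex on the same set $X$; $\Sigma_{(-1)}=\{\varnothing\}$. $I_\Sigma\subseteq R$ is generated by the monomials $\prod_{x\in A}x$ with $A\subseteq X$, $A\notin\Sigma$; $\mathbb K[\Sigma]=R/I_\Sigma$. If $D$ is the Krull dimension of $\mathbb K[\Sigma]$ and its Hilbert series is $h(t)/(1-t)^{D}$, the multiplicity is $e(\mathbb K[\Sigma])=h(1)$. Chordal clique complexes: let $\Delta$ be the complex of cliques of a finite chordal graph with vertex set $X$, having $e\ge2$ maximal cliques. A leaf order of its facets (maximal cliques) is an ordering $S_1,\ldots,S_e$ such that for each $m\ge2$ there is $p(m)<m$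 satisfying $S_m\cap S_i\subseteq S_m\cap S_{p(m)}$ for all $i<m$; such an order exists. For $1\le m\le e-1$ the separators are $Q_m=(S_1\cup\cdots\cup S_m)\cap S_{m+1}=S_{p(m+1)}\cap S_{m+1}$ (possibly empty), and $r_m=|Q_m|$. Binomial convention: $\binom ab=0$ if $a<0$, $b<0$ or $b>a$; otherwise it is the usual binomial coefficient. *)

(* Defs.v *)
From HB Require Import structures.
From mathcomp Require Import all_boot all_order all_algebra.
From mathcomp Require Export mpoly.
From mathcomp Require boolp.

Set Implicit Arguments.
Unset Strict Implicit.
Unset Printing Implicit Defensive.

Import Order.TTheory GRing.Theory Num.Theory.
Local Open Scope ring_scope.
Local Open Scope quotient_scope.

(* The empty set is required to be a face, so the void complex, which has no
   dimension, is excluded.  Elements of X need not lie in any face. *)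
Record complex (X : finType) := Complex {
  faces :> {set {set X}};
  faces0 : set0 \in faces;
  faces_sub : forall F G : {set X}, F \in faces -> G \subset F -> G \in faces
}.

Section Complexes.
Variable X : finType.
Implicit Type D : complex X.

Definition face_dim (F : {set X}) : int := #|F|%:Z - 1.

Definition complex_dim D : int := (\max_(F in faces D) #|F|)%N%:Z - 1.

Definition facets D : {set {set X}} := [set F | maxset (fun G => G \in faces D) F].

Definition skeleton_faces D (k : int) : {set {set X}} :=
  [set F in faces D | face_dim F <= k].

Lemma skeleton0 D (k : int) : -1 <= k -> set0 \in skeleton_faces D k.
Proof. by move=> hk; rewrite inE faces0 /face_dim cards0 sub0r. Qed.

Lemma skeleton_sub D (k : int) (F G : {set X}) :
  F \in skeleton_faces D k -> G \subset F -> G \in skeleton_faces D k.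
Proof.
rewrite !inE => /andP[FD Fk] GF; rewrite (faces_sub FD GF) /=.
by apply: le_trans Fk; rewrite lerD2r lez_nat subset_leq_card.
Qed.

Definition skeleton D (k : int) (hk : -1 <= k) : complex X :=
  Complex (skeleton0 D hk) (@skeleton_sub D k).

Definition clique (g : rel X) (F : {set X}) : bool :=
  [forall x in F, forall y in F, (x != y) ==> g x y].

Lemma clique0 (g : rel X) : set0 \in [set F | clique g F].
Proof. by rewrite inE; apply/forall_inP => x; rewrite inE. Qed.

Lemma clique_sub (g : rel X) (F G : {set X}) :
  F \in [set F | clique g F] -> G \subset F -> G \in [set F | clique g F].
Proof.
rewrite !inE => /forall_inP cF /subsetP GF.
apply/forall_inP => x xG; apply/forall_inP => y yG.
by move/forall_inP: (cF x (GF x xG)); apply; apply: GF.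
Qed.

Definition clique_complex (g : rel X) : complex X :=
  Complex (clique0 g) (@clique_sub g).

(* The chord joins two vertices that are not consecutive on the cycle; they
   are distinct as soon as g is irreflexive. *)
Definition chordal (g : rel X) : Prop :=
  forall c : seq X, (3 < size c)%N -> ucycle g c ->
  exists x y : X,
    [/\ x \in c, y \in c, g x y, y != next c x & x != next c y].

(* Facets are numbered from 0: the m-th facet of the list is S_{m+1}. *)
Definition leaf_order D (S : seq {set X}) : Prop :=
  [/\ uniq S, S =i facets D &
      forall m : nat, (0 < m < size S)%N ->
      exists p : nat, (p < m)%N /\
        forall i : nat, (i < m)%N ->
          nth set0 S m :&: nth set0 S i \subset nth set0 S m :&: nth set0 S p].

(* Q_m for 1 <= m < size S, since nth set0 S m is S_{m+1}. *)
Definition separator (S : seq {set X}) (m : nat) : {set X} :=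
  (\bigcup_(i < m) nth set0 S i) :&: nth set0 S m.

End Complexes.

Definition binz (a b : int) : int :=
  match a, b with
  | Posz a, Posz b => 'C(a, b)%:Z
  | _, _ => 0
  end.

Section FaceRing.
Variables (K : fieldType) (X : finType) (D : complex X).

(* The variable attached to x : X is 'X_(enum_rank x). *)
Definition face_monomial (A : {set X}) : {mpoly K[#|X|]} :=
  \prod_(x in A) 'X_(enum_rank x).

Definition in_SR_ideal (p : {mpoly K[#|X|]}) : Prop :=
  exists c : {set X} -> {mpoly K[#|X|]},
    p = \sum_(A : {set X} | A \notin faces D) c A * face_monomial A.

Definition SR_pred : {pred {mpoly K[#|X|]}} :=
  fun p => boolp.asbool (in_SR_ideal p).

Lemma SR_predP p : reflect (in_SR_ideal p) (p \in SR_pred).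
Proof. exact: boolp.asboolP. Qed.

Lemma SR_pred_closed : idealr_closed SR_pred.
Proof.
split.
- by apply/SR_predP; exists (fun=> 0); rewrite big1 // => A _; rewrite mul0r.
- apply/SR_predP => -[c /(congr1 (meval (fun=> 0)))].
  rewrite meval1 rmorph_sum /= big1 => [/eqP|A AD]; first by rewrite oner_eq0.
  have /set0Pn[x xA] : A != set0.
    by apply: contraNneq AD => ->; exact: faces0.
  by rewrite mevalM /face_monomial (bigD1 x) //= mevalM mevalXU mul0r mulr0.
- move=> a u v /SR_predP[c ->] /SR_predP[d ->]; apply/SR_predP.
  exists (fun A => a * c A + d A); rewrite mulr_sumr -big_split /=.
  by apply: eq_bigr => A _; rewrite mulrDl mulrA.
Qed.

HB.instance Definition _ :=
  isIdealr.Build {mpoly K[#|X|]} SR_pred SR_pred_closed.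

Definition SR_ideal : idealr {mpoly K[#|X|]} := SR_pred.

Definition face_ring : comNzRingType := {ideal_quot SR_ideal}.

End FaceRing.

(* Strict chains P_0 < ... < P_d.  Prime ideals of the library are boolean
   predicates, which is no restriction in the presence of [boolp.asbool]. *)
Definition prime_chain (A : comNzRingType) (d : nat) : Prop :=
  exists P : 'I_d.+1 -> prime_idealr A,
    forall i j : 'I_d.+1, (i < j)%N ->
      {subset P i <= P j} /\ ~ {subset P j <= P i}.

Definition is_krull_dim (A : comNzRingType) (d : nat) : Prop :=
  prime_chain A d /\ forall d' : nat, prime_chain A d' -> (d' <= d)%N.

Section Multiplicity.
Variables (K : fieldType) (n : nat) (I : idealr {mpoly K[n]}).

(* The degree d component of the graded ring R / I (I homogeneous) is the
   image of the forms of degree d; its dimension over K is h when the classes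
   of some h forms of degree d are a basis of it. *)
Definition is_hilbert_fun (d h : nat) : Prop :=
  exists b : 'I_h -> {mpoly K[n]},
    (forall i, b i \is d.-homog) /\
    forall p : {mpoly K[n]}, p \is d.-homog ->
      exists! c : {ffun 'I_h -> K},
        p = \sum_(i < h) c i *: b i %[mod {ideal_quot I}].

(* The coefficientwise identity says that h(t) = (1 - t)^D * H(t), where
   H(t) is the Hilbert series and D the Krull dimension of R / I. *)
Definition is_multiplicity (e : int) : Prop :=
  exists (H : nat -> nat) (D : nat) (h : {poly int}),
    [/\ forall d, is_hilbert_fun d (H d),
        is_krull_dim {ideal_quot I} D,
        forall N : nat,
          h`_N = \sum_(j < N.+1) ((1 - 'X) ^+ D : {poly int})`_j * (H (N - j)%N)%:Z
      & e = h.[1] ].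

End Multiplicity.

(* Main.v *)
From HB Require Import structures.
Require Import Defs.
From mathcomp Require Import all_boot all_order all_algebra.

Set Implicit Arguments.
Unset Strict Implicit.
Unset Printing Implicit Defensive.

Import Order.TTheory GRing.Theory Num.Theory.
Local Open Scope ring_scope.
Local Open Scope quotient_scope.

(** Two facts hold for every simplicial complex Sigma whose largest faces have
    r vertices: the face ring has Krull dimension r, and its multiplicity is
    the number of faces with r vertices.  Since k < dim Delta, the k-skeleton
    of Delta has r = k + 1, and its faces with r vertices are those of Delta,
    so the theorem reduces to counting the cliques with r vertices.

    The count (card_faces_leaf_order) adds the facets one at a time.  A subset
    of S_m that lies in an earlier facet lies in S_m :&: S_p(m), which is the
    separator Q; so S_m contributes 'C(n_m, r) subsets, of which
    'C(#|Q|, r) have already been counted.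

    Everything about the face ring rests on its monomial basis
    (mem_SR_idealP): a polynomial is in the Stanley-Reisner ideal iff it has
    no monomial whose variables form a face.

    Lower bound for the dimension: a face G gives the prime kernel of setting
    the variables outside G to 0, and removing the vertices of a face one by
    one gives a strict chain (prime_chain_face).

    Upper bound: if P_0 < ... < P_d is a chain of primes and u_i is in
    P_(i+1) but not in P_i, then the u_i are algebraically independent modulo
    P_0 (prime_chain_independent): in a relation, divide by the least power of
    u_0, which is allowed modulo P_0, and then read the relation modulo P_1,
    where u_0 vanishes; this leaves a relation between the other u_i.  Hence
    the (N + 1) ^ d monomials in the u_i with exponents at most N are linearly
    independent.  But they live in a space spanned by O(N ^ r) monomials,
    those supported on faces and of degree O(N); so d <= r
    (prime_chain_leq).

    Hilbert series: summing t ^ deg over the monomials with exact support F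
    gives (t / (1 - t)) ^ #|F|, so h(t) is the sum over the faces F of
    (1 - t) ^ (r - #|F|) t ^ #|F|, and at t = 1 only the faces with r vertices
    count (coef_h_poly, horner1_h_poly).  The series is handled through the
    polynomials that enumerate the monomials with all exponents at most M,
    which agree with it up to degree M. *)

(** * Chains of primes and algebraic independence *)

Section PrimeChainIndependence.
Variables (A : comNzRingType) (d N : nat).
Variables (P : 'I_d.+1 -> prime_idealr A) (u : 'I_d -> A).
Hypothesis uP : forall i : 'I_d, u i \in P (lift ord0 i).
Hypothesis uNP : forall i : 'I_d, u i \notin P (widen_ord (leqnSn d) i).
Hypothesis sP : forall i : 'I_d, {subset P (widen_ord (leqnSn d) i) <= P (lift ord0 i)}.

(** The u_i are algebraically independent modulo P_0 over coefficients that
    survive in the last prime.  A polynomial is encoded by its set U of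
    exponent vectors, so that passing from P_j to P_(j+1) only shrinks U to
    its slice of vectors with least j-th exponent; no variable needs to be
    split off.  The last slice is a single exponent vector, whose coefficient
    would have to be in the last prime. *)
Lemma prime_chain_independent (U : {set {ffun 'I_d -> 'I_N}})
    (c : {ffun 'I_d -> 'I_N} -> A) :
    (forall a, a \in U -> c a \notin P ord_max) ->
    \sum_(a in U) c a * \prod_i u i ^+ a i \in P ord0 ->
  U = set0.
Proof.
move=> cN h0; apply/eqP/set0Pn => U0.
have step (j : 'I_d.+1) : exists V : {set {ffun 'I_d -> 'I_N}},
  [/\ V != set0, V \subset U,
      forall a b, a \in V -> b \in V -> forall i : 'I_d, (i < j)%N -> a i = b i &
      \sum_(a in V) c a * \prod_(i < d | (j <= i)%N) u i ^+ a i \in P j].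
  case: j => j; elim: j => [|j IH] jd.
    exists U; split=> //; first exact/set0Pn.
    by rewrite (_ : Ordinal jd = ord0) //; apply: val_inj.
  have [V [/set0Pn[a0 a0V] VU eqV VP]] := IH (ltnW jd).
  pose i0 : 'I_d := Ordinal (jd : (j < d)%N).
  have Hlo : Ordinal (ltnW jd) = widen_ord (leqnSn d) i0 by apply: val_inj.
  have Hhi : Ordinal jd = lift ord0 i0 by apply: val_inj.
  rewrite Hlo in VP; rewrite Hhi.
  (* Dividing by u_j ^ (b i0) leaves the terms of the slice W, and the others
     still contain u_j, hence vanish modulo P_(j+1). *)
  case: (arg_minnP (fun a : {ffun 'I_d -> 'I_N} => a i0 : nat) a0V).
  move=> b; rewrite -/(b \in V) => bV bmin.
  pose W := [set a in V | a i0 == b i0].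
  exists W; split.
  - by apply/set0Pn; exists b; rewrite inE bV /=.
  - by apply: subset_trans VU; apply/subsetP=> a; rewrite inE => /andP[].
  - move=> a1 a2; rewrite !inE => /andP[a1V /eqP e1] /andP[a2V /eqP e2] i.
    rewrite ltnS leq_eqVlt => /orP[/eqP ij|]; last exact: eqV.
    by have -> : i = i0 by [apply: val_inj]; rewrite e1 e2.
  pose t (a : {ffun 'I_d -> 'I_N}) :=
    c a * \prod_(i < d | (j < i)%N) u i ^+ a i.
  have tE a : c a * \prod_(i < d | (j <= i)%N) u i ^+ a i = u i0 ^+ a i0 * t a.
    rewrite (bigD1 i0) //= mulrCA; congr (_ * (_ * _)).
    by apply: eq_bigl => i; rewrite ltn_neqAle andbC eq_sym.
  have {VP} : u i0 ^+ b i0 * \sum_(a in V) u i0 ^+ (a i0 - b i0) * t a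
      \in P (widen_ord (leqnSn d) i0).
    suff -> : u i0 ^+ b i0 * \sum_(a in V) u i0 ^+ (a i0 - b i0) * t a =
      \sum_(a in V) c a * \prod_(i < d | (j <= i)%N) u i ^+ a i by exact: VP.
    rewrite mulr_sumr; apply: eq_bigr => a aV.
    by rewrite tE mulrA -exprD subnKC // bmin.
  have uX n : u i0 ^+ n \notin P (widen_ord (leqnSn d) i0).
    elim: n => [|n IHn]; first by rewrite expr0 idealr1.
    by rewrite exprS prime_idealrM negb_or uNP.
  rewrite prime_idealrM (negbTE (uX _)) => /sP.
  rewrite (bigID (fun a : {ffun 'I_d -> 'I_N} => a i0 == b i0)) /= rpredDr.
    rewrite /t (eq_bigl (fun a => a \in W)); last by move=> a; rewrite inE.
    rewrite (eq_bigr t) // => a; rewrite inE => /andP[_ /eqP->].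
    by rewrite subnn mul1r.
  apply: rpred_sum => a /andP[aV ab].
  have : (b i0 < a i0)%N by rewrite ltn_neqAle eq_sym ab bmin.
  rewrite -subn_gt0; case: (_ - _)%N => // k _.
  by rewrite mulrC; apply: idealMr; rewrite exprSr; apply: idealMr.
have [V [/set0Pn[a aV] VU eqV]] := step ord_max.
rewrite (big_pred1 a) => [|b /=].
  rewrite big_pred0 => [|i]; last by rewrite leqNgt ltn_ord.
  by rewrite mulr1; apply/negP/cN/(subsetP VU).
apply/idP/eqP => [bV|-> //]; apply/ffunP => i.
exact: eqV bV aV i (ltn_ord i).
Qed.
End PrimeChainIndependence.

(** * The monomial basis of the face ring *)

Definition monomial_vars (X : finType) (m : 'X_{1..#|X|}) : {set X} :=
  [set x | m (enum_rank x) != 0%N].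

Section StanleyReisnerIdeal.
Variables (K : fieldType) (X : finType) (D : complex X).
Local Notation I := (SR_ideal K D).

(** Turns the product over a set of vertices into a single monomial, for which
    divisibility is a comparison of exponents. *)
Lemma face_monomialE (A : {set X}) :
  face_monomial K A = 'X_[[multinom (enum_val i \in A : nat) | i < #|X|]].
Proof.
rewrite /face_monomial mpolyXE_id (reindex_onto enum_rank enum_val) /=; last first.
  by move=> i _; rewrite enum_valK.
rewrite big_mkcond; apply: eq_big => [x|x _]; first by rewrite enum_rankK eqxx.
by rewrite mnmE enum_rankK; case: (x \in A).
Qed.

(** The monomials whose variables form a face are a basis of the face ring: a
    multiple of a non-face monomial only has monomials divisible by it, and a
    monomial supported on a non-face A is a multiple of the monomial of A. *)
Lemma mem_SR_idealP (p : {mpoly K[#|X|]}) :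
  reflect (forall m, monomial_vars m \in faces D -> p@_m = 0) (p \in I).
Proof.
apply: (iffP idP) => [/SR_predP[c ->] m mD | p0].
  rewrite raddf_sum /=; apply: big1 => A AD; apply/eqP.
  rewrite face_monomialE mcoeff_eq0 (perm_mem (msuppMX _ _)).
  apply/negP => /mapP[m' _ mE]; case/negP: AD; apply: faces_sub mD _.
  apply/subsetP => x xA; rewrite inE mE mnmDE mnmE enum_rankK xA.
  by rewrite addn_eq0.
rewrite (mpolyE p); apply: rpred_sum => m _.
have [mD|mD] := boolP (monomial_vars m \in faces D).
  by rewrite p0 // scale0r rpred0.
rewrite -mul_mpolyC; apply: idealMr.
set A := monomial_vars m.
have -> : 'X_[m] = 'X_[m - [multinom (enum_val i \in A : nat) | i < #|X|]]
           * face_monomial K A.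
  rewrite face_monomialE -mpolyXD submK //; apply/mnm_lepP => i.
  by rewrite mnmE inE enum_valK; case: (m i).
apply: idealMr; apply/SR_predP.
exists (fun B => (B == A)%:R); rewrite (bigD1 A) //= eqxx mul1r big1 ?addr0 //.
by move=> B /andP[_ /negbTE->]; rewrite mul0r.
Qed.

Lemma face_ring_eq0 (p : {mpoly K[#|X|]}) :
  (\pi_{ideal_quot I} p == 0) = (p \in I).
Proof. by rewrite -[p in RHS]subr0 Quotient.idealrBE raddf0. Qed.

End StanleyReisnerIdeal.

(** * Krull dimension: upper bound *)

Section StandardExponents.
Variables (X : finType) (D : complex X).

(** Monomials with bounded exponents are encoded by functions on the vertices
    rather than by bounded multinomials: these functions are indexed by X
    itself, and sums over them factor into products over X. *)
Definition exponent_mnm M (a : {ffun X -> 'I_M.+1}) : 'X_{1..#|X|} :=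
  [multinom (a (enum_val i) : nat) | i < #|X|].

Definition exponent_supp M (a : {ffun X -> 'I_M.+1}) : {set X} :=
  [set x | a x != ord0].

Definition standard_exponents M : {set {ffun X -> 'I_M.+1}} :=
  [set a | exponent_supp a \in faces D].

Lemma monomial_vars_exponent M (a : {ffun X -> 'I_M.+1}) :
  monomial_vars (exponent_mnm a) = exponent_supp a.
Proof. by apply/setP=> x; rewrite !inE mnmE enum_rankK. Qed.

Lemma exponent_mnm_inj M : injective (@exponent_mnm M).
Proof.
move=> a b /mnmP eab; apply/ffunP=> x; apply: val_inj.
by have:= eab (enum_rank x); rewrite !mnmE enum_rankK.
Qed.

Lemma mdeg_exponent M (a : {ffun X -> 'I_M.+1}) :
  mdeg (exponent_mnm a) = (\sum_x a x)%N.
Proof.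
rewrite mdegE (reindex_onto enum_rank enum_val) /=; last first.
  by move=> i _; rewrite enum_valK.
by apply: eq_big => [x|x _]; rewrite ?mnmE enum_rankK ?eqxx.
Qed.

Lemma exponent_mnm_surj M (m : 'X_{1..#|X|}) : (mdeg m <= M)%N ->
  exists a : {ffun X -> 'I_M.+1}, exponent_mnm a = m.
Proof.
move=> mM; exists [ffun x => inord (m (enum_rank x))].
apply/mnmP => i; rewrite mnmE ffunE enum_valK inordK // ltnS.
by apply: leq_trans mM; rewrite mdegE (bigD1 i) //= leq_addr.
Qed.

(** Only the exponent r of M.+1 matters: it makes the number of standard
    monomials grow as a polynomial of degree r. *)
Lemma card_standard_exponents M r :
  (forall F, F \in faces D -> (#|F| <= r)%N) ->
  (#|standard_exponents M| <= 2 ^ #|X| * M.+1 ^ r)%N.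
Proof.
move=> Dr; rewrite -sum1_card.
rewrite (partition_big (@exponent_supp M) (fun F => F \in faces D)) /=; last first.
  by move=> a; rewrite inE.
rewrite -cardsT -card_powerset.
apply: leq_trans (_ : \sum_(F in faces D) M.+1 ^ r <= _)%N; last first.
  rewrite sum_nat_const leq_mul2r subset_leq_card ?orbT //.
  by apply/subsetP=> F _; rewrite inE subsetT.
apply: leq_sum => F FD.
apply: leq_trans (_ : M.+1 ^ #|F| <= _)%N; last by rewrite leq_pexp2l // Dr.
rewrite -[M.+1 in leqRHS]card_ord -(card_pffun_on ord0) sum1_card.
apply/subset_leq_card/subsetP => a /andP[_ /eqP aF].
apply/pffun_onP; split=> [|y _ //].
  by apply/subsetP=> x; rewrite -aF !inE.
Qed.

End StandardExponents.

Section KrullUpperBound.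
Variables (K : fieldType) (X : finType) (D : complex X).
Local Notation I := (SR_ideal K D).

(** More polynomials of degree at most M than there are standard monomials
    with exponents at most M must be linearly dependent modulo the ideal,
    since their classes are determined by the coefficients at those
    monomials. *)
Lemma SR_ideal_dependent M (T : finType) (p : T -> {mpoly K[#|X|]}) :
    (forall t, (msize (p t) <= M.+1)%N) ->
    (#|standard_exponents D M| < #|T|)%N ->
  exists2 v : T -> K, (exists t, v t != 0) & \sum_t v t *: p t \in I.
Proof.
move=> pM ltT; set s := #|standard_exponents D M| in ltT.
pose B : 'M[K]_(#|T|, s) :=
  \matrix_(i, j) (p (enum_val i))@_(exponent_mnm (enum_val j)).
have kerB0 : kermx B != 0.
  rewrite -mxrank_eq0 mxrank_ker subn_eq0 -ltnNge.
  exact: leq_ltn_trans (rank_leq_col B) ltT.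
pose w := nz_row (kermx B).
have wB : w *m B = 0 by apply/sub_kermxP; apply: nz_row_sub.
exists (fun t => w 0 (enum_rank t)).
  have: w != 0 by rewrite nz_row_eq0.
  by case/rV0Pn => i wi; exists (enum_val i); rewrite enum_valK.
apply/mem_SR_idealP => m mD; rewrite raddf_sum /=.
have [mM | Mm] := leqP (mdeg m) M; last first.
  apply: big1 => t _; rewrite mcoeffZ memN_msupp_eq0 ?mulr0 //.
  by apply: msize_mdeg_ge; apply: leq_trans Mm.
have [a aE] := exponent_mnm_surj mM.
have aS : a \in standard_exponents D M by rewrite inE -monomial_vars_exponent aE.
transitivity ((w *m B) 0 (enum_rank_in aS a)); last by rewrite wB mxE.
rewrite mxE [RHS](reindex_onto enum_rank enum_val) /=; last first.
  by move=> i _; rewrite enum_valK.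
apply: eq_big => [t|t _]; first by rewrite enum_rankK eqxx.
by rewrite mcoeffZ !mxE enum_rankK enum_rankK_in // aE.
Qed.

Lemma msize_prod_exp d N c (g : 'I_d -> {mpoly K[#|X|]}) (e : 'I_d -> 'I_N) :
  (forall i, (msize (g i) <= c.+1)%N) ->
  (msize (\prod_i g i ^+ e i) <= (d * N * c).+1)%N.
Proof.
move=> gc.
have mulS (p q : {mpoly K[#|X|]}) k l : (msize p <= k.+1)%N ->
    (msize q <= l.+1)%N -> (msize (p * q) <= (k + l).+1)%N.
  move=> pk ql; have [->|p0] := eqVneq p 0; first by rewrite mul0r msize0.
  have [->|q0] := eqVneq q 0; first by rewrite mulr0 msize0.
  rewrite msizeM //; apply: leq_trans (_ : (k.+1 + l.+1).-1 <= _)%N.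
    by rewrite -!subn1 leq_sub2r // leq_add.
  by rewrite addSn addnS.
have expS (p : {mpoly K[#|X|]}) n : (msize p <= c.+1)%N ->
    (msize (p ^+ n) <= (n * c).+1)%N.
  move=> pc; elim: n => [|n IH]; first by rewrite expr0 msize1.
  by rewrite exprS mulSn; apply: mulS.
apply: leq_trans (_ : (\sum_(i < d) N * c).+1 <= _)%N; last first.
  by rewrite sum_nat_const card_ord mulnA.
elim/big_ind2: _ => [|p k q l kp lq|i _]; first by rewrite msize1.
  exact: mulS.
apply: leq_trans (expS _ _ (gc i)) _.
by rewrite ltnS leq_mul2r (ltnW (ltn_ord _)) orbT.
Qed.

(** With d > r, the N ^ d monomials in the separating elements g_i with
    exponents less than N would outnumber the C * N ^ r standard monomials
    that can occur in them, as soon as N > C; the resulting linear relation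
    contradicts prime_chain_independent. *)
Lemma prime_chain_leq d r :
  (forall F, F \in faces D -> (#|F| <= r)%N) ->
  prime_chain (face_ring K D) d -> (d <= r)%N.
Proof.
move=> Dr [P chainP]; rewrite leqNgt; apply/negP => ltrd.
have sP (i : 'I_d) : {subset P (widen_ord (leqnSn d) i) <= P (lift ord0 i)}.
  by apply: (chainP _ _ _).1; rewrite /= /bump.
have [g gP] : exists g : 'I_d -> {mpoly K[#|X|]}, forall i,
    \pi_{ideal_quot I} (g i) \in P (lift ord0 i) /\
    \pi_{ideal_quot I} (g i) \notin P (widen_ord (leqnSn d) i).
  suff ex (i : 'I_d) : exists h : {mpoly K[#|X|]},
      \pi_{ideal_quot I} h \in P (lift ord0 i) /\
      \pi_{ideal_quot I} h \notin P (widen_ord (leqnSn d) i).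
    by exists (fun i => sval (boolp.cid (ex i))) => i; case: boolp.cid.
  have /boolp.existsNP[x /boolp.not_implyP[xP xNP]] :=
    (chainP (widen_ord (leqnSn d) i) (lift ord0 i) (leqnn _)).2.
  by exists (repr x); rewrite reprK; split=> //; apply/negP.
pose c := \max_i msize (g i).
have gc i : (msize (g i) <= c.+1)%N by apply: leqW; apply: leq_bigmax.
(* (d * N * c).+1 <= (d * c).+1 * N, so C * N ^ r bounds the number of
   standard monomials of exponents at most M; C does not depend on N. *)
pose C := (2 ^ #|X| * (d * c).+1 ^ r)%N.
pose N := C.+1; pose M := (d * N * c)%N.
pose p (e : {ffun 'I_d -> 'I_N}) := \prod_i g i ^+ e i.
have [| |v [e ve] vI] := @SR_ideal_dependent M _ p.
- by move=> e; apply: msize_prod_exp.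
- apply: leq_ltn_trans (card_standard_exponents M Dr) _.
  rewrite card_ffun !card_ord.
  apply: leq_ltn_trans (_ : C * N ^ r < _)%N.
    rewrite /C -mulnA -expnMn leq_mul2l; apply/orP; right.
    have [->|r_gt0] := posnP r; first by rewrite !expn0.
    by rewrite leq_exp2r // /M mulSn mulnAC addnC -addn1 leq_add2l.
  apply: leq_trans (_ : N ^ r.+1 <= _)%N; last by rewrite leq_pexp2l.
  by rewrite expnS ltn_mul2r expn_gt0 ltnSn.
have U0 : [set e | v e != 0] = set0.
  apply: (@prime_chain_independent _ d N P (fun i => \pi_{ideal_quot I} (g i))
      _ _ sP _ (fun e => \pi_{ideal_quot I} ((v e)%:MP))).
  - by move=> i; case: (gP i).
  - by move=> i; case: (gP i).
  - move=> a; rewrite inE => va; apply/negP => aP.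
    have := idealMr (\pi_{ideal_quot I} ((v a)^-1%:MP)) aP.
    by rewrite -rmorphM -mpolyCM mulVf // mpolyC1 rmorph1 idealr1.
  suff -> : \sum_(a in [set e | v e != 0]) \pi_{ideal_quot I} ((v a)%:MP) *
      \prod_i \pi_{ideal_quot I} (g i) ^+ a i = 0 :> face_ring K D by exact: rpred0.
  transitivity (\pi_{ideal_quot I} (\sum_e v e *: p e)); last first.
    by apply/eqP; rewrite face_ring_eq0.
  rewrite raddf_sum /= big_mkcond; apply: eq_bigr => a _.
  rewrite inE; case: eqVneq => [->|_] /=; first by rewrite scale0r raddf0.
  by rewrite -mul_mpolyC rmorphM rmorph_prod; congr (_ * _); apply: eq_bigr => i _; rewrite rmorphXn.
have : e \in [set e0 | v e0 != 0] by rewrite inE.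
by rewrite U0 inE.
Qed.
End KrullUpperBound.

(** * Krull dimension: lower bound *)

Section KrullLowerBound.
Variables (K : fieldType) (X : finType) (D : complex X).
Local Notation I := (SR_ideal K D).
Local Notation R := {mpoly K[#|X|]}.

(** The projection onto the polynomial ring in the variables of G, composed
    with its inclusion; staying in the same ring makes the ideals for different
    G directly comparable. *)
Definition restrict_vars (G : {set X}) : R -> R :=
  mmap (@mpolyC #|X| K)
    (fun i : 'I_#|X| => if enum_val i \in G then 'X_i else 0 : R).

HB.instance Definition _ G := GRing.RMorphism.on (restrict_vars G).

Lemma restrict_varsX G x :
  restrict_vars G 'X_(enum_rank x) = if x \in G then 'X_(enum_rank x) else 0.
Proof. by rewrite /restrict_vars mmapX mmap1U enum_rankK. Qed.

Lemma restrict_vars_comp (G H : {set X}) p :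
  H \subset G -> restrict_vars H (restrict_vars G p) = restrict_vars H p.
Proof.
move=> /subsetP HG; rewrite {2}/restrict_vars {1}/mmap rmorph_sum /=.
rewrite [RHS]/restrict_vars [RHS]/mmap; apply: eq_bigr => m _.
rewrite rmorphM /= {1}/restrict_vars mmapC; congr (_ * _).
rewrite /mmap1 rmorph_prod; apply: eq_bigr => i _; rewrite rmorphXn /=.
congr (_ ^+ _); have [_|iG] := ifPn.
  by rewrite -{1}(enum_valK i) restrict_varsX enum_valK.
by rewrite rmorph0; case: ifP => // /HG; rewrite (negbTE iG).
Qed.

Lemma restrict_vars_SR_ideal G p :
  G \in faces D -> p \in I -> restrict_vars G p = 0.
Proof.
move=> GD /SR_predP[c ->]; rewrite rmorph_sum; apply: big1 => A AD.
have /subsetPn[x xA xG] : ~~ (A \subset G).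
  by apply: contra AD; apply: faces_sub.
rewrite rmorphM /= /face_monomial rmorph_prod (bigD1 x) //= restrict_varsX.
by rewrite (negbTE xG) mul0r mulr0.
Qed.

(** The kernel of the map that restrict_vars G induces on the face ring.  That
    G is a face is what makes this map well defined; the proof is a parameter
    so that the ideal structure can be attached to the predicate. *)
Definition face_ideal_pred G (GD : G \in faces D) : {pred face_ring K D} :=
  fun q => restrict_vars G (repr q) == 0.

Lemma mem_face_ideal_pi G (GD : G \in faces D) (p : R) :
  (\pi_{ideal_quot I} p \in face_ideal_pred GD) = (restrict_vars G p == 0).
Proof.
rewrite unfold_in /face_ideal_pred.
suff -> : restrict_vars G (repr (\pi_{ideal_quot I} p)) = restrict_vars G p by [].
apply/eqP; rewrite -subr_eq0 -rmorphB; apply/eqP/restrict_vars_SR_ideal => //.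
by rewrite Quotient.idealrBE reprK.
Qed.

Lemma face_ideal_closed G (GD : G \in faces D) : idealr_closed (face_ideal_pred GD).
Proof.
split.
- by rewrite -[0](rmorph0 (\pi_{ideal_quot I})) mem_face_ideal_pi rmorph0.
- by rewrite -[1](rmorph1 (\pi_{ideal_quot I})) mem_face_ideal_pi rmorph1 oner_eq0.
move=> a u v; rewrite -[a]reprK -[u]reprK -[v]reprK.
rewrite -rmorphM -rmorphD !mem_face_ideal_pi => /eqP u0 /eqP v0.
by rewrite rmorphD rmorphM /= u0 v0 mulr0 addr0.
Qed.

Lemma face_ideal_prime G (GD : G \in faces D) :
  prime_idealr_closed (face_ideal_pred GD).
Proof.
move=> u v; rewrite -[u]reprK -[v]reprK -rmorphM !mem_face_ideal_pi.
by rewrite rmorphM mulf_eq0.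
Qed.

HB.instance Definition _ G (GD : G \in faces D) :=
  isIdealr.Build (face_ring K D) (face_ideal_pred GD) (face_ideal_closed GD).
HB.instance Definition _ G (GD : G \in faces D) :=
  isPrimeIdealrClosed.Build (face_ring K D) (face_ideal_pred GD)
    (@face_ideal_prime G GD).

Definition face_ideal G (GD : G \in faces D) : prime_idealr (face_ring K D) :=
  face_ideal_pred GD.

(** A smaller face has a larger ideal, and the inclusion is strict because of
    the variable of any vertex that was removed. *)
Lemma face_ideal_proper G H (GD : G \in faces D) (HD : H \in faces D) :
  H \proper G ->
  {subset face_ideal GD <= face_ideal HD} /\
  ~ {subset face_ideal HD <= face_ideal GD}.
Proof.
move=> /properP[HG [x xG xH]]; split=> [q|sub].
  rewrite -[q]reprK !mem_face_ideal_pi => /eqP q0.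
  by rewrite -(restrict_vars_comp _ HG) q0 rmorph0.
have := sub (\pi_{ideal_quot I} 'X_(enum_rank x)).
rewrite !mem_face_ideal_pi !restrict_varsX (negbTE xH) xG eqxx => /(_ isT).
by rewrite -msize_poly_eq0 msizeX.
Qed.

Lemma prime_chain_face F : F \in faces D -> prime_chain (face_ring K D) #|F|.
Proof.
move=> FD.
(* G i keeps the first #|F| - i vertices of F. *)
pose G (i : 'I_#|F|.+1) := [set x in F | (index x (enum F) < #|F| - i)%N].
have GD i : G i \in faces D.
  by apply: faces_sub FD _; apply/subsetP=> x; rewrite inE => /andP[].
exists (fun i => face_ideal (GD i)) => i j ltij.
apply: face_ideal_proper; apply/properP; split.
  apply/subsetP=> x; rewrite !inE => /andP[-> /=] /leq_trans; apply.
  by rewrite leq_sub2l // ltnW.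
have ltj : (#|F| - j < #|F|)%N.
  have j0 : (0 < j)%N by apply: leq_ltn_trans ltij.
  by rewrite ltn_subrL j0 (leq_trans j0) // -ltnS.
have ix : index (enum_val (Ordinal ltj)) (enum F) = (#|F| - j)%N.
  rewrite (enum_val_nth (enum_val (Ordinal ltj))) index_uniq ?enum_uniq //.
  by rewrite -cardE.
exists (enum_val (Ordinal ltj)); rewrite !inE ix enum_valP ?ltnn //=.
by rewrite ltn_sub2l // (leq_trans ltij) // -ltnS.
Qed.

Lemma krull_dim_face_ring F :
  F \in faces D -> (forall G, G \in faces D -> (#|G| <= #|F|)%N) ->
  is_krull_dim (face_ring K D) #|F|.
Proof.
move=> FD Fmax; split; first exact: prime_chain_face.
by move=> d; apply: prime_chain_leq.
Qed.

End KrullLowerBound.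

(** * Hilbert series and multiplicity *)

Section StandardCount.
Variables (X : finType) (D : complex X).

(** Exponents bounded by e suffice to list the monomials of degree e, but a
    single bound M is needed to compare several degrees; hence M is kept apart
    from e, and card_standard_of_degree removes the dependence on M. *)
Definition standard_of_degree M e : {set {ffun X -> 'I_M.+1}} :=
  [set a in standard_exponents D M | (\sum_x a x)%N == e].

Definition standard_count e := #|standard_of_degree e e|.

Lemma card_standard_of_degree M e :
  (e <= M)%N -> #|standard_of_degree M e| = standard_count e.
Proof.
move=> eM; have eM1 : (e.+1 <= M.+1)%N by [].
pose w (a : {ffun X -> 'I_e.+1}) := [ffun x => widen_ord eM1 (a x)].
have w_inj : injective w.
  move=> a b /ffunP wab; apply/ffunP => x; apply: val_inj.
  by have /(congr1 val) := wab x; rewrite !ffunE.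
rewrite /standard_count -(card_imset _ w_inj); apply: eq_card => a.
have wsupp b : exponent_supp (w b) = exponent_supp b.
  by apply/setP=> x; rewrite !inE ffunE.
have wsum b : (\sum_x w b x = \sum_x b x)%N.
  by apply: eq_bigr => x _; rewrite ffunE.
apply/idP/imsetP => [|[b]]; rewrite !inE; last first.
  by move=> bD ->; rewrite wsupp wsum.
move=> /andP[aD /eqP ae].
have ax x : (a x < e.+1)%N by rewrite ltnS -ae (bigD1 x) //= leq_addr.
exists [ffun x => Ordinal (ax x)]; last first.
  by apply/ffunP => x; apply: val_inj; rewrite !ffunE.
rewrite !inE; apply/andP; split; last first.
  by apply/eqP; rewrite -[RHS]ae; apply: eq_bigr => x _; rewrite ffunE.
suff -> : exponent_supp [ffun x => Ordinal (ax x)] = exponent_supp a by [].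
by apply/setP=> x; rewrite !inE ffunE.
Qed.

(** The truncated Hilbert series: all standard monomials of degree at most M
    are enumerated, and only some of those of larger degree. *)
Definition standard_poly M : {poly int} :=
  \sum_(a in standard_exponents D M) 'X^(\sum_x a x)%N.

Lemma coef_standard_poly M e :
  (e <= M)%N -> (standard_poly M)`_e = (standard_count e)%:Z.
Proof.
move=> /card_standard_of_degree <-; rewrite coef_sum -sum1_card.
rewrite (bigID (fun a : {ffun X -> 'I_M.+1} => (\sum_x a x)%N == e)) /=.
rewrite [X in _ + X]big1 => [|a /andP[_ /negbTE ae]]; last first.
  by rewrite coefXn eq_sym ae.
rewrite addr0 -[RHS]natz natr_sum; apply: eq_big => [a|a /andP[_ ae]]; first by rewrite [RHS]inE.
by rewrite coefXn eq_sym ae.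
Qed.

(** A standard monomial is the choice of its support F and of a positive
    exponent for each vertex of F. *)
Lemma standard_polyE M :
  standard_poly M =
  \sum_(F in faces D) (\sum_(e < M.+1 | e != ord0) 'X^e) ^+ #|F|.
Proof.
rewrite /standard_poly (partition_big (@exponent_supp X M) (fun F => F \in faces D)) /=;
  last by move=> a; rewrite inE.
apply: eq_bigr => F FD.
transitivity (\prod_x \sum_(e < M.+1 | (e != ord0) == (x \in F)) 'X^e : {poly int}).
  rewrite bigA_distr_big_dep /=; apply: eq_big => a; last first.
    by move=> _; rewrite -prodrXr.
  rewrite inE; apply/andP/familyP => [[_ /eqP aF] x|aF].
    by rewrite -topredE /= -aF inE eqxx.
  have -> : exponent_supp a = F.
    by apply/setP => x; have /eqP <- := aF x; rewrite inE.
  by rewrite FD eqxx.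
rewrite (bigID (fun x => x \in F)) /= [X in _ * X]big1 ?mulr1 => [|x /negbTE xF].
  rewrite -prodr_const; apply: eq_bigr => x xF.
  by apply: eq_bigl => e; rewrite xF eqb_id.
rewrite (big_pred1 ord0) ?expr0 // => e.
by rewrite xF eqbF_neg negbK.
Qed.

Definition h_poly r : {poly int} :=
  \sum_(F in faces D) (1 - 'X) ^+ (r - #|F|) * 'X^#|F|.

(** With E = 'X + ... + 'X^N we have (1 - 'X) * E = 'X - 'X^(N.+1), which is
    'X up to degree N; so multiplying E ^ #|F| by (1 - 'X) ^ r gives the term
    of F in the h-polynomial up to degree N. *)
Lemma coef_h_poly r N :
  (forall F, F \in faces D -> (#|F| <= r)%N) ->
  (h_poly r)`_N = ((1 - 'X) ^+ r * standard_poly N)`_N.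
Proof.
move=> Dr; rewrite standard_polyE mulr_sumr !coef_sum; apply: eq_bigr => F FD.
have E1 : (1 - 'X) * (\sum_(e < N.+1 | e != ord0) 'X^e) = 'X - 'X^(N.+1) :> {poly int}.
  have -> : \sum_(e < N.+1 | e != ord0) 'X^e =
            \sum_(e < N.+1) 'X^e - 1 :> {poly int}.
    by rewrite [in RHS](bigD1 ord0) //= expr0 addrAC subrr add0r.
  rewrite mulrBr mulr1 -{1}[1 - 'X]opprB mulNr -subrX1.
  by rewrite !opprB addrC addrA subrK.
rewrite -{2}(subnK (Dr F FD)) exprD -mulrA -exprMn E1.
apply/eqP; rewrite -subr_eq0 -coefB -mulrBr subrXX.
by rewrite subKr mulrCA coefXnM ltnSn.
Qed.

Lemma horner1_h_poly r :
  (forall F, F \in faces D -> (#|F| <= r)%N) ->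
  (h_poly r).[1] = #|[set F in faces D | #|F| == r]|%:Z.
Proof.
move=> Dr; rewrite horner_sum -sum1_card -[RHS]natz natr_sum.
rewrite (bigID (fun F : {set X} => #|F| == r)) /= addrC big1 ?add0r.
  apply: eq_big => [F|F /andP[_ /eqP->]]; first by rewrite inE.
  by rewrite subnn expr0 mul1r !hornerE expr1n.
move=> F /andP[FD Fr]; rewrite hornerM horner_exp !hornerE subrr expr0n.
by rewrite subn_eq0 leqNgt ltn_neqAle Fr Dr ?mul0r.
Qed.
End StandardCount.

Section HilbertFunction.
Variables (K : fieldType) (X : finType) (D : complex X).
Local Notation I := (SR_ideal K D).

(** A form is congruent to its standard part, whose coefficients depend only on
    the class of the form; hence the standard monomials of degree e give a
    basis of the component of degree e. *)
Lemma hilbert_fun_face_ring e : is_hilbert_fun I e (standard_count D e).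
Proof.
pose A := standard_of_degree D e e.
pose mon (i : 'I_#|A|) := exponent_mnm (enum_val i).
have mon_inj : injective mon by move=> i j /exponent_mnm_inj/enum_val_inj.
have monA (i : 'I_#|A|) : enum_val i \in A := enum_valP i.
have coefb (c : {ffun 'I_#|A| -> K}) j : (\sum_i c i *: 'X_[mon i])@_(mon j) = c j.
  rewrite raddf_sum (bigD1 j) //= mcoeffZ mcoeffX eqxx mulr1 big1 ?addr0 // => i ij.
  by rewrite mcoeffZ mcoeffX (inj_eq mon_inj) (negbTE ij) mulr0.
exists (fun i => 'X_[mon i]); split=> [i|p pe].
  rewrite dhomogX /= mdeg_exponent.
  by have := monA i; rewrite inE => /andP[_].
exists [ffun i => p@_(mon i)]; split=> [|c pc].
  apply/eqP; rewrite -Quotient.idealrBE; apply/mem_SR_idealP => m mD.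
  rewrite mcoeffB; have [me|me] := eqVneq (mdeg m) e; last first.
    rewrite (dhomog_nemf_coeff pe me) raddf_sum /= big1 ?subrr // => i _.
    rewrite mcoeffZ mcoeffX; case: eqP => [mi|_]; last by rewrite mulr0.
    case/negP: me; rewrite -mi /mon mdeg_exponent.
    by have := monA i; rewrite inE => /andP[_].
  have [a aE] := exponent_mnm_surj (eq_leq me).
  have aA : a \in A.
    by rewrite !inE -monomial_vars_exponent aE mD -mdeg_exponent aE me eqxx.
  have <- : mon (enum_rank_in aA a) = m by rewrite /mon enum_rankK_in.
  by rewrite coefb ffunE subrr.
apply/ffunP => i; rewrite ffunE -(coefb c i).
move/eqP: pc; rewrite -Quotient.idealrBE => /mem_SR_idealP/(_ (mon i)).
rewrite mcoeffB => pc; apply/eqP; rewrite -subr_eq0; apply/eqP/pc.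
by have := monA i; rewrite monomial_vars_exponent !inE => /andP[].
Qed.

Lemma multiplicity_face_ring F :
  F \in faces D -> (forall G, G \in faces D -> (#|G| <= #|F|)%N) ->
  is_multiplicity I #|[set G in faces D | #|G| == #|F|]|%:Z.
Proof.
move=> FD Fmax; exists (standard_count D), #|F|, (h_poly D #|F|); split.
- exact: hilbert_fun_face_ring.
- exact: krull_dim_face_ring FD Fmax.
- move=> N; rewrite coef_h_poly // coefM; apply: eq_bigr => j _.
  by rewrite coef_standard_poly // leq_subr.
- by rewrite horner1_h_poly.
Qed.
End HilbertFunction.

(** * Counting faces along a leaf order *)

Section LeafOrderCount.
Variables (X : finType) (D : complex X) (S : seq {set X}) (r : nat).
Hypothesis leafS : leaf_order D S.

Definition subsets_of_card (A : {set X}) : {set {set X}} :=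
  [set F : {set X} | F \subset A & #|F| == r].

(** The leaf order enters here: a subset of the separator, which is a union of
    traces S_m :&: S_i, lies in the single facet S_p that contains all these
    traces. *)
Lemma subsets_of_card_separator m : (0 < m < size S)%N ->
  (\bigcup_(i < m) subsets_of_card (nth set0 S i)) :&: subsets_of_card (nth set0 S m)
  = subsets_of_card (separator S m).
Proof.
case: leafS => _ _ leaf mS; have [p [pm Sp]] := leaf m mS.
apply/setP => F; rewrite !inE; apply/andP/andP.
  case=> /bigcupP[i _]; rewrite inE => /andP[Fi Fr] /andP[Fm _]; split=> //.
  by rewrite subsetI Fm andbT (subset_trans Fi) // (bigcup_sup i).
case=> FQ Fr; have Fm : F \subset nth set0 S m.
  by apply: subset_trans FQ (subsetIr _ _).
split; last by rewrite Fm Fr.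
apply/bigcupP; exists (Ordinal pm) => //; rewrite inE Fr andbT.
apply/subsetP => x /(subsetP FQ); rewrite inE => /andP[/bigcupP[i _ xi] xm].
have /subsetP/(_ x) := Sp i (ltn_ord i); rewrite !inE xm xi => /(_ isT).
by case/andP.
Qed.

(** Inclusion-exclusion, one facet at a time; stated additively because
    subtraction of natural numbers is truncated. *)
Lemma card_faces_leaf_order :
  (#|[set F in faces D | #|F| == r]| + \sum_(1 <= m < size S) 'C(#|separator S m|, r)
   = \sum_(0 <= m < size S) 'C(#|nth set0 S m|, r))%N.
Proof.
have -> : [set F in faces D | #|F| == r] =
    \bigcup_(i < size S) subsets_of_card (nth set0 S i).
  case: leafS => _ facetS _.
  apply/setP => F; rewrite inE; apply/andP/bigcupP => [[FD Fr]|[i _]].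
    have [G Gmax FG] := maxset_exists (P := fun G => G \in faces D) FD.
    have GS : G \in S by rewrite facetS inE.
    exists (Ordinal (etrans (index_mem G S) GS)) => //=.
    by rewrite inE /= nth_index // FG.
  rewrite inE => /andP[Fi ->]; split=> //.
  have : nth set0 S i \in facets D by rewrite -facetS mem_nth.
  by rewrite inE => /maxsetP[iD _]; apply: faces_sub iD Fi.
suff H m : (m <= size S)%N ->
    (#|\bigcup_(i < m) subsets_of_card (nth set0 S i)|
       + \sum_(1 <= i < m) 'C(#|separator S i|, r)
     = \sum_(0 <= i < m) 'C(#|nth set0 S i|, r))%N by exact: H.
elim: m => [|m IH] mS; first by rewrite big_ord0 cards0 !big_geq.
rewrite big_ord_recr [RHS]big_nat_recr //= -(IH (ltnW mS)) -cards_draws.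
case: m {IH} mS => [|m] mS.
  by rewrite big_ord0 set0U cards0 !big_geq // addn0.
rewrite [in LHS]big_nat_recr //= [in RHS]addnAC -cardsUI.
rewrite -/(subsets_of_card _) subsets_of_card_separator //.
by rewrite cards_draws [in RHS]addnAC addnA.
Qed.
End LeafOrderCount.

Theorem corollary1 (K : fieldType) (X : finType) (g : rel X)
    (g_sym : symmetric g) (g_irr : irreflexive g) (g_chordal : chordal g)
    (S : seq {set X}) (S_gt1 : (1 < size S)%N)
    (S_leaf : leaf_order (clique_complex g) S)
    (k : int) (k_ge : -1 <= k) (k_lt : k < complex_dim (clique_complex g)) :
  is_krull_dim (face_ring K (skeleton (clique_complex g) k_ge)) `|(k + 1)%R|%N /\
  is_multiplicity (SR_ideal K (skeleton (clique_complex g) k_ge))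
    (\sum_(0 <= m < size S) binz #|nth set0 S m| (k + 1)
     - \sum_(1 <= m < size S) binz #|separator S m| (k + 1)).
Proof.
set D := clique_complex g in S_leaf k_lt *.
have [r kr] : exists r : nat, k + 1 = r%:Z.
  by exists `|(k + 1)%R|%N; rewrite gez0_abs // -lerBlDr sub0r.
have skelE (F : {set X}) :
    (F \in faces (skeleton D k_ge)) = (F \in faces D) && (#|F| <= r)%N.
  by rewrite inE /face_dim lerBlDr kr.
have [F FD Fr] : exists2 F : {set X}, F \in faces D & #|F| = r.
  have D0 : (0 < #|faces D|)%N by apply/card_gt0P; exists set0; apply: faces0.
  have [F0 F0D maxF0] := eq_bigmax_cond (fun F : {set X} => #|F|) D0.
  move: k_lt; rewrite /complex_dim maxF0 ltrBrDr kr ltz_nat => rF0.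
  have : (0 < 'C(#|F0|, r))%N by rewrite bin_gt0 ltnW.
  rewrite -cards_draws => /card_gt0P[F]; rewrite inE => /andP[FF0 /eqP Fr].
  by exists F => //; apply: faces_sub F0D FF0.
have Fskel : F \in faces (skeleton D k_ge) by rewrite skelE FD Fr leqnn.
have Fmax G : G \in faces (skeleton D k_ge) -> (#|G| <= #|F|)%N.
  by rewrite skelE Fr => /andP[].
rewrite kr absz_nat -Fr; split; first exact: krull_dim_face_ring.
have := multiplicity_face_ring K Fskel Fmax.
have -> : [set G in faces (skeleton D k_ge) | #|G| == #|F|] =
          [set G in faces D | #|G| == #|F|].
  apply/setP => G; rewrite inE [RHS]inE skelE Fr -andbA.
  by case: eqP => [->|]; rewrite ?leqnn // !andbF.
suff -> : \sum_(0 <= m < size S) binz #|nth set0 S m| #|F|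
     - \sum_(1 <= m < size S) binz #|separator S m| #|F| =
     #|[set G in faces D | #|G| == #|F| ]|%:Z by [].
apply/eqP; rewrite subr_eq; apply/eqP.
have sumZ (a b : nat) (f : nat -> nat) :
    \sum_(a <= m < b) binz (f m) #|F| = (\sum_(a <= m < b) 'C(f m, #|F|))%:Z.
  by rewrite -[RHS]natz natr_sum; apply: eq_bigr => m _; rewrite natz.
by rewrite !sumZ -(card_faces_leaf_order #|F| S_leaf) PoszD.
Qed.
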